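(* Let $n$ and $m$ be integers such that $m\geq 3$ and $n\geq \frac{m^2}{2}-3$. Then $\gamma^{\mathrm{ID}}_{D}(\mathcal P_{m,n})\leq \left\lceil\frac{n}{2}\right\rceil+m-1$.
   Context: For integers $m,n\geq1$, $\mathcal P_{m,n}$ denotes the set of points $(x,y)\in\mathbb Z^2$ with $1\leq y\leq m$ and $1\leq x\leq n$ (so $m$ rows and $n$ columns). A disk of radius $r>0$ and center $c\in\mathbb R^2$ is the set of points of $\mathbb R^2$ at Euclidean distance at most $r$ from $c$. A point is covered by a disk if it belongs to it; two points are separated by a disk if exactly one of them is covered by it. A set $\mathcal D$ of disks identifies a finite set $\mathcal P\subseteq\mathbb R^2$ if every point of $\mathcal P$ is covered by some disk of $\mathcal D$ and every pair of distinct points of $\mathcal P$ is separated by some disk of $\mathcal D$. $\gamma^{\mathrm{ID}}_{D}(\mathcal P)$ denotes the minimum number of disks (of arbitrary radii) in a set identifying $\mathcal P$. *)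

(* Defs.v *)
From HB Require Import structures.
From mathcomp Require Import all_boot all_order all_algebra.
From mathcomp Require Import finmap.
From mathcomp Require Import all_classical all_reals.
From mathcomp Require Import ring lra.

Set Implicit Arguments.
Unset Strict Implicit.
Unset Printing Implicit Defensive.
Import Order.TTheory GRing.Theory Num.Theory.
Local Open Scope ring_scope.

(* The library norm on [R * R] is the sup norm, hence an explicit distance. *)
Definition edist (R : realType) (p q : R * R) : R :=
  Num.sqrt ((p.1 - q.1) ^+ 2 + (p.2 - q.2) ^+ 2).

Definition disk (R : realType) (c : R * R) (r : R) : set (R * R) :=
  [set p | edist p c <= r]%classic.

(* Disks are handled as point sets; for positive radii the point set determines
   centre and radius, so counting point sets is counting disks. *)
Definition is_disk (R : realType) (A : set (R * R)) : Prop :=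
  exists c r, 0 < r /\ A = disk c r.

Definition separates (R : realType) (A : set (R * R)) (p q : R * R) : Prop :=
  (A p /\ ~ A q) \/ (~ A p /\ A q).

Definition identifies (R : realType) (D : {fset set (R * R)})
    (P : {fset R * R}) : Prop :=
  (forall p, p \in P -> exists2 A, A \in D & A p) /\
  (forall p q, p \in P -> q \in P -> p <> q ->
     exists2 A, A \in D & separates A p q).

Definition identifiable (R : realType) (P : {fset R * R}) (k : nat) : Prop :=
  exists D : {fset set (R * R)},
    [/\ forall A, A \in D -> is_disk A, identifies D P & #|` D| = k].

Lemma edist_ge0 (R : realType) (p q : R * R) : 0 <= edist p q.
Proof. exact: sqrtr_ge0. Qed.

Lemma edistxx (R : realType) (p : R * R) : edist p p = 0.
Proof. by rewrite /edist !subrr expr0n addr0 sqrtr0. Qed.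

Lemma edist_gt0 (R : realType) (p q : R * R) : p <> q -> 0 < edist p q.
Proof.
move=> npq; rewrite sqrtr_gt0 lt_neqAle addr_ge0 ?sqr_ge0 // andbT eq_sym.
rewrite paddr_eq0 ?sqr_ge0 // !sqrf_eq0 !subr_eq0; apply/negP.
by case: p q npq => [a b] [c d] /= npq /andP[/eqP ac /eqP bd]; apply: npq; rewrite ac bd.
Qed.

Lemma edist_small_radius (R : realType) (P : seq (R * R)) (p : R * R) :
  exists2 r : R, 0 < r & forall q, q \in P -> p <> q -> r < edist q p.
Proof.
elim: P => [|a P [r r0 Hr]]; first by exists 1.
have [->|/eqP npa] := eqVneq a p.
  by exists r => // q; rewrite inE => /orP[/eqP -> //|]; exact: Hr.
have d0 : 0 < edist a p by exact: edist_gt0.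
exists (Num.min r (edist a p / 2)); first by rewrite lt_min r0 divr_gt0.
move=> q; rewrite inE gt_min => /orP[/eqP -> _|qP npq]; last by rewrite Hr.
by apply/orP; right; lra.
Qed.

Lemma identifiable_ex (R : realType) (P : {fset R * R}) :
  exists k, `[< identifiable P k >].
Proof.
pose rad p := s2val (cid2 (edist_small_radius P p)).
have rad0 p : 0 < rad p by rewrite /rad; case: cid2.
have radP p q : q \in P -> p <> q -> rad p < edist q p.
  by rewrite /rad; case: cid2 => r /= _; apply.
pose D := [fset disk p (rad p) | p in P]%fset.
have DP p : p \in P -> disk p (rad p) \in D by move=> pP; apply: in_imfset.
have selfP p : disk p (rad p) p by rewrite /disk /= edistxx ltW.
exists #|` D|; apply/asboolP; exists D; split=> // [A|].
  by case/imfsetP => p /= _ ->; exists p, (rad p).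
split=> [p pP|p q pP qP npq]; exists (disk p (rad p)); rewrite ?DP //.
by left; split => //; rewrite /disk /= leNgt radP.
Qed.

Definition gammaID (R : realType) (P : {fset R * R}) : nat :=
  ex_minn (identifiable_ex P).

Definition grid (R : realType) (m n : nat) : {fset R * R} :=
  [fset ((p.1)%:R, (p.2)%:R) | p in [seq (x, y) | x <- iota 1 n, y <- iota 1 m]]%fset.

Lemma gridP (R : realType) (m n : nat) (p : R * R) :
  p \in grid R m n <->
  exists x y : int, [/\ 1 <= x <= n%:Z, 1 <= y <= m%:Z & p = (x%:~R, y%:~R)].
Proof.
split.
  case/imfsetP => -[x y] /= /allpairsP[[a b] /= []].
  rewrite !mem_iota !add1n !ltnS => ax bx [-> ->] ->.
  by exists a%:Z, b%:Z.
case=> -[x|x] [[y|y]] [] // xP yP ->.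
apply/imfsetP; exists (x, y) => //=.
by apply/allpairsP; exists (x, y); rewrite !mem_iota !add1n !ltnS.
Qed.

(* Main.v *)
(** Let [k] be the ceiling of [n / 2].  A disk covering the [k] columns
    [i + 1, ..., i + k] in each of the [m] rows and no other column exists as
    soon as [(m - 1)^2 < 4 k]; taking [i = 1, ..., k], the boundaries of these
    disks cross all gaps between consecutive columns, most disks serving two
    gaps at distance [k].  The disk [i = k] is only asked to act as a half-plane
    on the grid, so it can be taken large, which settles [m = 3], [n = 2].
    Together with [m - 1] large disks acting as half-planes between consecutive
    rows, they separate all pairs; turning the first half-plane upwards and the
    others downwards also covers every point. *)
Require Import Defs.
From mathcomp Require Import all_boot all_order all_algebra.
From mathcomp Require Import finmap.
From mathcomp Require Import all_classical all_reals.
From mathcomp Require Import zify ring lra.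
Import Order.TTheory GRing.Theory Num.Theory.
Local Open Scope ring_scope.

(* Four times the squared distance from [(x, y)] to the centre is the integer
   [(2 x - a - b)^2 + (2 y - h - 1)^2]; it must not exceed
   [4 r^2 = (b - a + 2)^2 - 1] exactly when [a <= x <= b]. *)
Lemma strip_ball (R : realType) (a b : int) (h : nat) :
  a <= b -> (h%:Z - 1) ^+ 2 < 4 * (b - a + 1) ->
  exists (c : R * R) (r : R), 0 < r /\
    forall x y : int, 1 <= y <= h%:Z ->
      (edist (x%:~R, y%:~R) c <= r) = (a <= x <= b).
Proof.
move=> ab hab.
pose N : int := (b - a + 2) ^+ 2 - 1.
have N0 : 0 < N by rewrite /N; nia.
exists ((a + b)%:~R / 2, (h%:Z + 1)%:~R / 2), (Num.sqrt (N%:~R / 4)).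
have r0 : 0 < N%:~R / 4 :> R by rewrite divr_gt0 ?ltr0z.
split=> [|x y hy]; first by rewrite sqrtr_gt0.
rewrite /edist /= ler_sqrt; last exact: ltW.
have -> : (x%:~R - (a + b)%:~R / 2) ^+ 2 + (y%:~R - (h%:Z + 1)%:~R / 2) ^+ 2
    = ((2 * x - a - b) ^+ 2 + (2 * y - h%:Z - 1) ^+ 2)%:~R / 4 :> R.
  rewrite !(rmorphD, rmorphB, rmorphXn, rmorphM, rmorphN) /=.
  by field.
rewrite ler_pM2r ?invr_gt0 // ler_int /N.
have hy2 : (2 * y - h%:Z - 1) ^+ 2 <= (h%:Z - 1) ^+ 2 by nia.
(* For [a <= x <= b] the sum is at most [(b - a)^2 + 4 (b - a + 1) - 1 = N], by [hab] and
   integrality. Otherwise [|2 x - a - b| >= b - a + 2], and the first square alone exceeds [N]. *)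
apply/idP/idP => [|/andP[ax xb]]; last by nia.
by move=> H; apply/andP; split; rewrite leNgt; apply/negP => ?; nia.
Qed.

Lemma column_strip_disk (R : realType) (a b : int) (h : nat) :
  a <= b -> (h%:Z - 1) ^+ 2 < 4 * (b - a + 1) ->
  exists2 A : set (R * R), is_disk A &
    forall x y : int, 1 <= y <= h%:Z -> A (x%:~R, y%:~R) <-> a <= x <= b.
Proof.
move=> ab hab; have [c [r [r0 cr]]] := strip_ball R a b h ab hab.
exists (disk c r); first by exists c, r.
by move=> x y hy; rewrite /disk /= cr.
Qed.

Lemma row_strip_disk (R : realType) (a b : int) (h : nat) :
  a <= b -> (h%:Z - 1) ^+ 2 < 4 * (b - a + 1) ->
  exists2 A : set (R * R), is_disk A &
    forall x y : int, 1 <= x <= h%:Z -> A (x%:~R, y%:~R) <-> a <= y <= b.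
Proof.
move=> ab hab; have [c [r [r0 cr]]] := strip_ball R a b h ab hab.
exists (disk (c.2, c.1) r); first by exists (c.2, c.1), r.
by move=> x y hx; rewrite /disk /= -(cr y x hx) /edist /= addrC.
Qed.

Lemma column_disk (R : realType) (m k i : nat) :
  (m%:Z - 1) ^+ 2 < 4 * k%:Z \/ k = 1%N -> (1 <= i <= k)%N ->
  exists2 A : set (R * R), is_disk A &
    forall x y : int, 1 <= y <= m%:Z -> 1 <= x <= k.*2%:Z ->
      A (x%:~R, y%:~R) <-> i%:Z < x <= i%:Z + k%:Z.
Proof.
move=> hk hi; have [ik|nik] := eqVneq i k; last first.
  have [||A dA AP] := @column_strip_disk R (i%:Z + 1) (i%:Z + k%:Z) m.
  - by lia.
  - by case: hk; lia.
  by exists A => // x y hy hx; rewrite (AP x y hy); lia.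
(* Columns beyond [2 k] are unconstrained, so the strip is lengthened on the right by [(m - 1)^2],
   enough for any [m]. When [k = 1] this is the only window. *)
have [||A dA AP] :=
    @column_strip_disk R (k%:Z + 1) (k%:Z + k%:Z + (m%:Z - 1) ^+ 2) m.
- by nia.
- by nia.
exists A => // x y hy hx; rewrite (AP x y hy) ik.
by have := sqr_ge0 (m%:Z - 1); lia.
Qed.

(** The strip is prolonged by [(n - 1)^2] past the outer row on its side, which makes it long enough
    for [n] columns. *)
Lemma row_disk (R : realType) (m n j : nat) : (1 <= j < m)%N ->
  exists2 A : set (R * R), is_disk A &
    forall x y : int, 1 <= x <= n%:Z -> 1 <= y <= m%:Z ->
      A (x%:~R, y%:~R) <-> (if j == 1%N then j%:Z < y else y <= j%:Z).
Proof.
move=> hj; have n0 := sqr_ge0 (n%:Z - 1).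
have [j1|j1] := eqVneq j 1%N.
  have [||A dA AP] := @row_strip_disk R (j%:Z + 1) (m%:Z + (n%:Z - 1) ^+ 2) n.
  - by lia.
  - by nia.
  by exists A => // x y hx hy; rewrite (AP x y hx); lia.
have [||A dA AP] := @row_strip_disk R (1 - (n%:Z - 1) ^+ 2) j%:Z n.
- by lia.
- by nia.
by exists A => // x y hx hy; rewrite (AP x y hx); lia.
Qed.

Lemma separating_window (k : nat) (a b : int) :
  1 <= a -> a < b -> b <= k.*2%:Z ->
  exists2 i : nat, (1 <= i <= k)%N &
    (i%:Z < a <= i%:Z + k%:Z) != (i%:Z < b <= i%:Z + k%:Z).
Proof.
move=> a1 ab bk; have [kab|kab] := ltP (a + k%:Z) b.
  by exists k; lia.
by have [ak|ak] := leP a k%:Z; [exists `|a|%N|exists `|a - k%:Z|%N]; lia.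
Qed.

Lemma separates_of_neq (R : realType) (A : set (R * R)) (p q : R * R)
    (u v : bool) : (A p <-> u) -> (A q <-> v) -> u != v -> separates A p q.
Proof.
case: u; case: v => // Ap Aq _; [left|right]; split.
- by apply/Ap.
- by move/Aq.
- by move/Ap.
- by apply/Aq.
Qed.

Lemma separatesC (R : realType) (A : set (R * R)) (p q : R * R) :
  separates A p q -> separates A q p.
Proof. by rewrite /separates; tauto. Qed.

Lemma gammaID_le (R : realType) (P : {fset R * R}) (D : {fset set (R * R)}) :
  (forall A, A \in D -> is_disk A) -> identifies D P ->
  (gammaID P <= #|` D|)%N.
Proof.
move=> dD iD; rewrite /gammaID; case: ex_minnP => g _; apply.
by apply/asboolP; exists D.
Qed.

(** Finite choice; the cardinality is only bounded, since two indices may receive the same disk. *)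
Lemma choose_disks (R : realType) (s : seq nat)
    (Q : nat -> set (R * R) -> Prop) :
  (forall i, i \in s -> exists2 A, is_disk A & Q i A) ->
  exists D : {fset set (R * R)},
    [/\ forall A, A \in D -> is_disk A, (#|` D| <= size s)%N &
        forall i, i \in s -> exists2 A, A \in D & Q i A].
Proof.
elim: s => [|i s IH] H.
  by exists fset0; rewrite cardfs0; split.
have [j js|D [dD cD QD]] := IH; first by apply: H; rewrite inE js orbT.
have [A dA QA] := H i (mem_head _ _).
exists (A |` D)%fset; split.
- by move=> B; rewrite !inE => /orP[/eqP -> //|/dD].
- by rewrite cardfsU1 /= -add1n leq_add // leq_b1.
move=> j; rewrite inE => /orP[/eqP ->|/QD[B BD QB]].
  by exists A; rewrite // !inE eqxx.
by exists B; rewrite // !inE BD orbT.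
Qed.

Lemma gammaID_grid_le (R : realType) (m n k : nat) :
  (3 <= m)%N -> (n <= k.*2)%N -> (m%:Z - 1) ^+ 2 < 4 * k%:Z \/ k = 1%N ->
  (gammaID (grid R m n) <= k + m.-1)%N.
Proof.
move=> m3 nk hk.
have [i|C [dC cC CP]] := @choose_disks R (iota 1 k) (fun i A =>
    forall x y : int, 1 <= y <= m%:Z -> 1 <= x <= k.*2%:Z ->
      A (x%:~R, y%:~R) <-> i%:Z < x <= i%:Z + k%:Z).
  by rewrite mem_iota => hi; apply: column_disk => //; lia.
have [j|W [dW cW WP]] := @choose_disks R (iota 1 m.-1) (fun j A =>
    forall x y : int, 1 <= x <= n%:Z -> 1 <= y <= m%:Z ->
      A (x%:~R, y%:~R) <-> (if j == 1%N then j%:Z < y else y <= j%:Z)).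
  by rewrite mem_iota => hj; apply: row_disk; lia.
have inC A : A \in C -> A \in (C `|` W)%fset by rewrite inE => ->.
have inW A : A \in W -> A \in (C `|` W)%fset by rewrite inE orbC => ->.
have sepx (x y x' y' : int) :
    1 <= x -> x < x' -> x' <= n%:Z -> 1 <= y <= m%:Z -> 1 <= y' <= m%:Z ->
    exists2 A, A \in (C `|` W)%fset &
      separates A (x%:~R, y%:~R) (x'%:~R, y'%:~R).
  move=> x1 xx' x'n hy hy'.
  have [|i hi ne] := @separating_window k x x' x1 xx'; first by lia.
  have [|A AC AP] := CP i; first by rewrite mem_iota; lia.
  exists A; first exact: inC.
  by apply: (separates_of_neq _ _ _ _ _ _ _ _ ne); apply: AP => //; lia.
have sepy (x y x' y' : int) :
    1 <= y -> y < y' -> y' <= m%:Z -> 1 <= x <= n%:Z -> 1 <= x' <= n%:Z ->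
    exists2 A, A \in (C `|` W)%fset &
      separates A (x%:~R, y%:~R) (x'%:~R, y'%:~R).
  move=> y1 yy' y'm hx hx'.
  have [|A AW AP] := WP `|y|%N; first by rewrite mem_iota; lia.
  exists A; first exact: inW.
  apply: (separates_of_neq _ _ _ _ _ _ (AP _ _ hx _) (AP _ _ hx' _));
    [lia|lia|case: ifP; lia].
apply: (@leq_trans #|` (C `|` W)%fset|).
  apply: gammaID_le => [A|]; first by rewrite inE => /orP[/dC|/dW].
  split=> [p /gridP[x [y [hx hy ->]]]|].
    (* Row 1 lies in the downward half-plane [j = 2], which exists because [m >= 3]; every other row
       lies in the upward one [j = 1]. *)
    have [y1|y1] := eqVneq y 1.
      have [|A AW AP] := WP 2%N; first by rewrite mem_iota; lia.
      by exists A; [exact: inW|apply/AP => //=; lia].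
    have [|A AW AP] := WP 1%N; first by rewrite mem_iota; lia.
    by exists A; [exact: inW|apply/AP => //=; lia].
  move=> p q /gridP[x [y [hx hy ->]]] /gridP[x' [y' [hx' hy' ->]]] npq.
  have [ylt|ylt|yy'] := ltgtP y y'.
  - by apply: sepy; lia.
  - by have [||||| A AD /separatesC AP] := @sepy x' y' x y; [lia..|exists A].
  have [xlt|xlt|xx'] := ltgtP x x'.
  - by apply: sepx; lia.
  - by have [||||| A AD /separatesC AP] := @sepx x' y' x y; [lia..|exists A].
  by case: npq; rewrite xx' yy'.
rewrite !size_iota in cC cW.
by rewrite (leq_trans _ (leq_add cC cW)) // cardfsU leq_subr.
Qed.

Theorem theorem6 (R : realType) (m n : nat)
    (hm : (3 <= m)%N)
    (hn : m%:R ^+ 2 / 2 - 3 <= n%:R :> R) :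
  (gammaID (grid R m n))%:Z <= Num.ceil (n%:R / 2 : R) + m%:Z - 1.
Proof.
have hn' : (m ^ 2 <= 2 * n + 6)%N.
  by rewrite -(ler_nat R) natrD natrM natrX; lra.
have hc : n%:Z <= 2 * Num.ceil (n%:R / 2 : R).
  rewrite -(ler_int R) rmorphM /= -[n%:~R]/(n%:R).
  by have := ceil_ge (n%:R / 2 : R); lra.
have := @gammaID_grid_le R m n (uphalf n) hm.
have nk : (n <= (uphalf n).*2)%N by lia.
move=> /(_ nk) H; have {}H : (gammaID (grid R m n) <= uphalf n + m.-1)%N.
  (* With [k = uphalf n], [hn'] gives [(m - 1)^2 <= 4 k + 7 - 2 m], which is below [4 k] once
     [m >= 4]. For [m = 3] the strict bound [4 < 4 k] fails only at [k = 1]. *)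
  apply: H; have [m3|m3] := eqVneq m 3%N; first by subst m; lia.
  by left; nia.
by lia.
Qed.
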